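(* Let $\mathcal R$ be a noncommutative ring with identity, let $n$ and $s_1,\dots,s_n$ be positive integers, and let $m=\sum_{j=1}^n s_j$. Let $M\in\mathcal R^{m\times m}$ be a block upper triangular matrix $$M=\begin{bmatrix} M_{11} & \cdots & M_{1n}\\ & \ddots & \vdots\\ & & M_{nn}\end{bmatrix},$$ where $M_{jk}\in\mathcal R^{s_j\times s_k}$ for $1\le j\le k\le n$, all blocks $M_{jk}$ with $j>k$ are zero, and each diagonal block $M_{kk}$ is invertible in the ring $\mathcal R^{s_k\times s_k}$. Let $l\in\{1,\dots,n-1\}$ and let $E=[E_{jk}]_{1\le j\le l,\,1\le k\le n-l}$ be a block matrix with $E_{jk}\in\mathcal R^{s_j\times s_{l+k}}$. Let $\widetilde M$ be the $m\times m$ matrix with the $2$-by-$2$ block form $$\widetilde M=\left[\begin{array}{c|c} M_{[l]} & M^{(1,l+1)}_{[l,n-l]}+E\\ \hline 0 & M^{(l+1,l+1)}_{[n-l]}\end{array}\right].$$ Write $M^{-1}=[M^{[-]}_{jk}]_{j,k=1}^n$ and $\widetilde M^{-1}=[\widetilde M^{[-]}_{jk}]_{j,k=1}^n$, where $M^{[-]}_{jk},\widetilde M^{[-]}_{jk}\in\mathcal R^{s_j\times s_k}$. Then $$\widetilde M^{[-]}_{jk}-M^{[-]}_{jk}=\begin{cases} -\left[M^{[-]}_{jj},\cdots,M^{[-]}_{jl}\right]\cdot E^{(j,1)}_{[l-j+1,k-l]}\cdot\begin{bmatrix} M^{[-]}_{l+1,k}\\ \vdots\\ M^{[-]}_{kk}\end{bmatrix},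 & j=1,\dots,l,\ k=l+1,\dots,n,\\[2mm] 0, & \text{otherwise},\end{cases}$$ where $0$ denotes the zero matrix in $\mathcal R^{s_j\times s_k}$.
   Context: $\mathcal R^{p\times q}$ denotes the set of $p\times q$ matrices over $\mathcal R$. For a block matrix $X$ with blocks $X_{jk}$ (indexed from $1$), $X^{(v,w)}_{[a,b]}$ denotes the block submatrix with block rows $v,\dots,v+a-1$ and block columns $w,\dots,w+b-1$; $X^{(v,w)}_{[a]}$ means $X^{(v,w)}_{[a,a]}$ and $X_{[a]}$ means $X^{(1,1)}_{[a]}$. Thus $M_{[l]}$ has block rows and columns $1,\dots,l$ of $M$; $M^{(1,l+1)}_{[l,n-l]}$ has block rows $1,\dots,l$ and block columns $l+1,\dots,n$; $M^{(l+1,l+1)}_{[n-l]}$ has block rows and columns $l+1,\dots,n$; and $E^{(j,1)}_{[l-j+1,k-l]}$ has block rows $j,\dots,l$ and block columns $1,\dots,k-l$ of $E$. A block upper triangular matrix over $\mathcal R$ whose diagonal blocks are invertible is invertible, so $M^{-1}$ and $\widetilde M^{-1}$ exist. *)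

(* Defs.v *)
From mathcomp Require Import all_boot all_order all_algebra.

Set Implicit Arguments.
Unset Strict Implicit.
Unset Printing Implicit Defensive.

Import GRing.Theory.
Local Open Scope ring_scope.

(* Block indices are natural numbers starting at 0, and a partition into n
   blocks is given by a function nat -> nat of which only the values at
   0, ..., n - 1 matter.  Block sizes then depend on the value of an index and
   not on a proof of its bound, so that products of block submatrices typecheck
   without casts. *)

(* [unitmx] is restricted to commutative rings. *)
Definition is_inverse (R : pzRingType) (d : nat) (A B : 'M[R]_d) : Prop :=
  A *m B = 1%:M /\ B *m A = 1%:M.

Definition invertible (R : pzRingType) (d : nat) (A : 'M[R]_d) : Prop :=
  exists B : 'M[R]_d, is_inverse A B.

(* Extends [submxblock] by zero to indices that are out of range. *)
Definition blk (R : pzRingType) (p q : nat -> nat) (a b : nat)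
    (X : 'M[R]_(\sum_(i < a) p i, \sum_(i < b) q i)) (j k : nat) :
    'M[R]_(p j, q k) :=
  match @idP (j < a)%N, @idP (k < b)%N with
  | ReflectT hj, ReflectT hk =>
      @submxblock R a b (fun i => p i) (fun i => q i) X
        (Ordinal hj) (Ordinal hk)
  | _, _ => 0
  end.

Arguments blk {R} p q {a b} X j k.

Lemma blkE (R : pzRingType) (p q : nat -> nat) (a b : nat)
    (X : 'M[R]_(\sum_(i < a) p i, \sum_(i < b) q i)) (j : 'I_a) (k : 'I_b) :
  blk p q X j k = @submxblock R a b (fun i => p i) (fun i => q i) X j k.
Proof.
case: j k => [j hj] [k hk]; rewrite /blk /=.
case: {-}_ / idP => [hj'|//]; case: {-}_ / idP => [hk'|//].
by rewrite (bool_irrelevance hj' hj) (bool_irrelevance hk' hk).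
Qed.

(* The submatrix of X with block rows v, ..., v + c - 1 and block columns
   w, ..., w + d - 1. *)
Definition blksub (R : pzRingType) (p q : nat -> nat) (a b : nat)
    (X : 'M[R]_(\sum_(i < a) p i, \sum_(i < b) q i)) (v w c d : nat) :
    'M[R]_(\sum_(i < c) p (v + i)%N, \sum_(i < d) q (w + i)%N) :=
  \mxblock_(i < c, j < d) blk p q X (v + i) (w + j).

Arguments blksub {R} p q {a b} X v w c d.

Lemma sum_sizes_split (s : nat -> nat) (n l : nat) : (l <= n)%N ->
  (\sum_(i < l) s i + \sum_(i < n - l) s (l + i) = \sum_(i < n) s i)%N.
Proof. by move=> ln; rewrite -[in RHS](subnKC ln) big_split_ord. Qed.

(* The matrix [M_[l], M^(1,l+1)_[l,n-l] + E; 0, M^(l+1,l+1)_[n-l]]. *)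
Definition perturb (R : pzRingType) (s : nat -> nat) (n l : nat)
    (ln : (l <= n)%N) (M : 'M[R]_(\sum_(i < n) s i))
    (E : 'M[R]_(\sum_(i < l) s i, \sum_(i < n - l) s (l + i)%N)) :
    'M[R]_(\sum_(i < n) s i) :=
  castmx (sum_sizes_split s ln, sum_sizes_split s ln)
    (block_mx (blksub s s M 0 0 l l) (blksub s s M 0 l l (n - l) + E)
              0                  (blksub s s M l l (n - l) (n - l))).

(* Main.v *)
Require Import Defs.
From mathcomp Require Import all_boot all_order all_algebra.

Set Implicit Arguments.
Unset Strict Implicit.
Unset Printing Implicit Defensive.

Import GRing.Theory.
Local Open Scope ring_scope.

(** The perturbed matrix is [M + F], where [F] places [E] in the upper right
    corner and is zero elsewhere ([perturbE]).  If [N] is the inverse of [M],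
    then [F *m N *m F = 0]: this product involves only the blocks of [N] in
    rows from [l] on and columns before [l], which vanish because [N] is block
    upper triangular ([corner_mul_upper_corner]).  Hence the Neumann series of
    [M + F = M *m (1 + N *m F)] stops after its linear term and
    [(M + F)^-1 = N - N *m F *m N], with no commutativity involved
    ([is_inverse_perturb]).

    The difference of the two inverses is therefore [- (N *m F *m N)].  Its
    block at [(j, k)] is a double sum over block indices [a] and [b] in which
    [N j a], [F a b] and [N b k] are all possibly nonzero only if
    [j <= a < l <= b <= k].  This range is empty unless [j < l <= k], and
    otherwise the sum is the announced triple product
    ([blk_upper_corner_upper]).

    That [M] has a block upper triangular inverse ([upper_inverse]) also comes
    from a finite geometric series: with [D] the block diagonal part of [M],
    [M = D *m (1 - U)] where [U] is strictly block upper triangular, hence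
    nilpotent. *)

(** * Calculus of blocks *)

Lemma sum_window (V : nmodType) (n a b : nat) (G : nat -> V) :
  (a <= b <= n)%N ->
  (forall i : nat, ~~ (a <= i < b)%N -> G i = 0) ->
  \sum_(i < n) G i = \sum_(c < b - a) G (a + c)%N.
Proof.
case/andP=> ab bn G0; rewrite -!(big_mkord xpredT).
rewrite (big_cat_nat (leq0n a) (leq_trans ab bn)) (big_cat_nat ab bn) /=.
rewrite big_nat big1 ?add0r => [|i /andP[_ ia]]; last first.
  by rewrite G0 // leqNgt ia.
rewrite [X in _ + X]big_nat [X in _ + X]big1 ?addr0; last first.
  move=> i /andP[bi _].
  by rewrite G0 // [(i < b)%N]ltnNge bi andbF.
rewrite -[X in \sum_(X <= _ < _) _]add0n big_addn.
rewrite !big_mkord.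
by apply: eq_bigr => i _; rewrite addnC.
Qed.

Lemma blk_out (R : pzRingType) (p q : nat -> nat) (a b : nat)
    (X : 'M[R]_(\sum_(i < a) p i, \sum_(i < b) q i)) (j k : nat) :
  ~~ ((j < a) && (k < b))%N -> blk p q X j k = 0.
Proof.
rewrite /blk; case: {-}_ / idP => [hj|//]; case: {-}_ / idP => [hk|//].
by rewrite hj hk.
Qed.

Lemma blkP (R : pzRingType) (p q : nat -> nat) (a b : nat)
    (X Y : 'M[R]_(\sum_(i < a) p i, \sum_(i < b) q i)) :
  (forall j k : nat, (j < a)%N -> (k < b)%N ->
     blk p q X j k = blk p q Y j k) ->
  X = Y.
Proof. by move=> XY; apply/mxblockP => j k; rewrite -!blkE XY. Qed.

Lemma blkD (R : pzRingType) (p q : nat -> nat) (a b : nat)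
    (X Y : 'M[R]_(\sum_(i < a) p i, \sum_(i < b) q i)) (j k : nat) :
  blk p q (X + Y) j k = blk p q X j k + blk p q Y j k.
Proof.
have [/andP[ja kb]|out] := boolP ((j < a) && (k < b))%N.
  by rewrite -[j]/(val (Ordinal ja)) -[k]/(val (Ordinal kb)) !blkE submxblockD.
by rewrite !blk_out // addr0.
Qed.

Lemma blkN (R : pzRingType) (p q : nat -> nat) (a b : nat)
    (X : 'M[R]_(\sum_(i < a) p i, \sum_(i < b) q i)) (j k : nat) :
  blk p q (- X) j k = - blk p q X j k.
Proof.
have [/andP[ja kb]|out] := boolP ((j < a) && (k < b))%N.
  by rewrite -[j]/(val (Ordinal ja)) -[k]/(val (Ordinal kb)) !blkE submxblockN.
by rewrite !blk_out // oppr0.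
Qed.

Lemma blk0 (R : pzRingType) (p q : nat -> nat) (a b j k : nat) :
  blk p q (0 : 'M[R]_(\sum_(i < a) p i, \sum_(i < b) q i)) j k = 0.
Proof.
have [/andP[ja kb]|out] := boolP ((j < a) && (k < b))%N.
  by rewrite -[j]/(val (Ordinal ja)) -[k]/(val (Ordinal kb)) blkE submxblock0.
by rewrite blk_out.
Qed.

Lemma blkM (R : pzRingType) (p q r : nat -> nat) (a b c : nat)
    (X : 'M[R]_(\sum_(i < a) p i, \sum_(i < b) q i))
    (Y : 'M[R]_(\sum_(i < b) q i, \sum_(i < c) r i)) (j k : nat) :
  blk p r (X *m Y) j k = \sum_(i < b) blk p q X j i *m blk q r Y i k.
Proof.
have [/andP[ja kc]|out] := boolP ((j < a) && (k < c))%N.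
  rewrite -[j]/(val (Ordinal ja)) -[k]/(val (Ordinal kc)) blkE.
  rewrite -[X in X *m _]submxblockK -[Y in _ *m Y]submxblockK.
  by rewrite mul_mxblock mxblockK; apply: eq_bigr => i _; rewrite !blkE.
rewrite blk_out // big1 // => i _.
move: out; rewrite negb_and => /orP[ja|kc].
  by rewrite [blk p q X j i]blk_out ?mul0mx // (negPf ja).
by rewrite [blk q r Y i k]blk_out ?mulmx0 // (negPf kc) andbF.
Qed.

Lemma blk_mxblock (R : pzRingType) (p q : nat -> nat) (a b : nat)
    (B : forall (i : 'I_a) (j : 'I_b), 'M[R]_(p i, q j)) (j : 'I_a) (k : 'I_b) :
  blk p q (\mxblock_(i < a, j < b) B i j) j k = B j k.
Proof. by rewrite blkE mxblockK. Qed.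

(** * Inverses of block upper triangular matrices *)

(** Vanishing below the [d]-th block superdiagonal: [d = 0] is block upper
    triangular and [d = 1] strictly so.  The parameter makes the filtration
    multiplicative, which gives both the triangularity of products and the
    nilpotence of strictly triangular matrices. *)
Definition upper_from (R : pzRingType) (s : nat -> nat) (n d : nat)
    (X : 'M[R]_(\sum_(i < n) s i)) : Prop :=
  forall j k : nat, (k < j + d)%N -> blk s s X j k = 0.

Lemma upper_fromD (R : pzRingType) (s : nat -> nat) (n d : nat)
    (X Y : 'M[R]_(\sum_(i < n) s i)) :
  upper_from d X -> upper_from d Y -> upper_from d (X + Y).
Proof. by move=> uX uY j k jk; rewrite blkD uX ?uY ?addr0. Qed.

Lemma upper_fromM (R : pzRingType) (s : nat -> nat) (n d e : nat)
    (X Y : 'M[R]_(\sum_(i < n) s i)) :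
  upper_from d X -> upper_from e Y -> upper_from (d + e) (X *m Y).
Proof.
move=> uX uY j k jk; rewrite blkM big1 // => i _.
have [ij|ji] := ltnP i (j + d); first by rewrite uX // mul0mx.
by rewrite (uY i k) ?mulmx0 // (leq_trans jk) // addnA leq_add2r.
Qed.

Lemma upper_from_eq0 (R : pzRingType) (s : nat -> nat) (n : nat)
    (X : 'M[R]_(\sum_(i < n) s i)) :
  upper_from n X -> X = 0.
Proof.
move=> uX; apply: blkP => j k _ kn.
by rewrite uX ?blk0 // (leq_trans kn) ?leq_addl.
Qed.

Lemma upper_from_mxdiag (R : pzRingType) (s : nat -> nat) (n : nat)
    (B : forall i : 'I_n, 'M[R]_(s i)) :
  upper_from 0 (\mxdiag_(i < n) B i : 'M[R]_(\sum_(i < n) s i)).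
Proof.
move=> j k; rewrite addn0 => kj.
have [/andP[jn kn]|out] := boolP ((j < n) && (k < n))%N;
  last by rewrite blk_out.
rewrite -[j]/(val (Ordinal jn)) -[k]/(val (Ordinal kn)) blk_mxblock.
by rewrite -val_eqE /= gtn_eqF.
Qed.

Lemma is_inverse_mul (R : pzRingType) (d : nat) (A A' B B' : 'M[R]_d) :
  is_inverse A A' -> is_inverse B B' -> is_inverse (A *m B) (B' *m A').
Proof.
move=> [AA' A'A] [BB' B'B]; split.
  by rewrite mulmxA -(mulmxA A) BB' mulmx1.
by rewrite mulmxA -(mulmxA B') A'A mulmx1.
Qed.

(** Over a noncommutative ring the telescoping identity [subrX1] gives a right
    inverse only; it is also a left inverse since [U] commutes with its
    powers. *)
Lemma is_inverse_geometric (R : pzRingType) (d n : nat) (U : 'M[R]_d) :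
  U ^+ n = 0 -> is_inverse (1%:M - U) (\sum_(i < n) U ^+ i).
Proof.
move=> Un0.
have SU : (1 - U) * (\sum_(i < n) U ^+ i) = 1.
  by rewrite -[1 - U]opprB mulNr -subrX1 Un0 sub0r opprK.
split; first by rewrite mulmxE.
rewrite mulmxE -[RHS]SU; apply/commr_sym/commr_sum => i _.
exact/commrX/commr_sym/commrB/commr_refl/commr1.
Qed.

Lemma mul_mxdiag (R : pzRingType) (n : nat) (p_ : 'I_n -> nat)
    (A B : forall i : 'I_n, 'M[R]_(p_ i)) :
  \mxdiag_(i < n) A i *m \mxdiag_(i < n) B i = \mxdiag_(i < n) (A i *m B i).
Proof.
rewrite mul_mxblock_mxdiag; apply: eq_mxblock => i j.
by case: eqVneq => [->|_]; rewrite ?conform_mx_id ?mul0mx.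
Qed.

(** Inverting the diagonal blocks writes [M] as [D *m (1 - U)] with [U]
    strictly block upper triangular.  Then [U ^+ n = 0], and the inverse
    [(\sum_(i < n) U ^+ i) *m D'] is block upper triangular because each of
    its factors is. *)
Lemma upper_inverse (R : pzRingType) (s : nat -> nat) (n : nat)
    (M : 'M[R]_(\sum_(i < n) s i)) :
  upper_from 0 M ->
  (forall k : nat, (k < n)%N -> invertible (blk s s M k k)) ->
  exists2 N : 'M[R]_(\sum_(i < n) s i), is_inverse M N & upper_from 0 N.
Proof.
move=> uM invM.
have [B BP] : exists B : forall i : 'I_n, 'M[R]_(s i),
    forall i : 'I_n, is_inverse (blk s s M i i) (B i).
  exact: (fin_all_exists (fun i : 'I_n => invM i (ltn_ord i))).
pose D : 'M[R]_(\sum_(i < n) s i) := \mxdiag_(i < n) blk s s M i i.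
pose D' : 'M[R]_(\sum_(i < n) s i) := \mxdiag_(i < n) B i.
have DD' : is_inverse D D'.
  by split; rewrite mul_mxdiag -(mxdiagZ (p_ := fun i : 'I_n => s i));
    apply: eq_mxdiag => i; case: (BP i).
have uDM : upper_from 1 (D - M).
  move=> j k; rewrite addn1 ltnS leq_eqVlt => /predU1P[->|kj].
    have [jn|jn] := ltnP j n; last by rewrite blk_out // ltnNge jn.
    rewrite blkD blkN -[j]/(val (Ordinal jn)).
    by rewrite blkE submxblock_diag subrr.
  rewrite blkD blkN uM ?addn0 // subr0.
  by apply: upper_from_mxdiag; rewrite addn0.
pose U := D' *m (D - M).
have uX i : upper_from i (U ^+ i).
  elim: i => [|i IHi]; last first.
    rewrite exprS -[i.+1]add1n; apply: upper_fromM IHi.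
    exact: upper_fromM (upper_from_mxdiag _) uDM.
  rewrite expr0 -[1]/(1%:M) -(mxdiagZ (p_ := fun i : 'I_n => s i)).
  exact: upper_from_mxdiag.
have -> : M = D *m (1%:M - U).
  by rewrite mulmxBr mulmx1 mulmxA DD'.1 mul1mx subKr.
exists ((\sum_(i < n) U ^+ i) *m D').
  apply: is_inverse_mul DD' _; apply: is_inverse_geometric.
  exact: upper_from_eq0.
rewrite -[0%N]/(0 + 0)%N; apply: upper_fromM (upper_from_mxdiag _).
elim/big_ind: _ => [j k _|X Y|i _]; [exact: blk0 | exact: upper_fromD |].
by move=> j k jk; apply: uX; rewrite (leq_trans jk) // addn0 leq_addr.
Qed.

(** * Two-by-two block forms *)

(** Block decompositions number the entries by [tagnat.Rank], while [block_mx]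
    numbers them by [lshift] and [rshift].  Both numberings add up the sizes of
    the preceding blocks, so they agree as natural numbers. *)
Lemma cast_Rank_lshift (s : nat -> nat) (n l : nat) (ln : (l <= n)%N)
    (j : 'I_l) (x : 'I_(s j)) :
  cast_ord (esym (sum_sizes_split s ln))
    (@tagnat.Rank n (fun i : 'I_n => s i) (widen_ord ln j) x) =
  lshift (\sum_(i < n - l) s (l + i)%N)
    (@tagnat.Rank l (fun i : 'I_l => s i) j x).
Proof.
apply: val_inj; apply: etrans (tagnat.RankEsum _) _.
apply: etrans _ (esym (tagnat.RankEsum _)).
rewrite -!big_ord_widen //.
  exact: ltnW.
exact: leq_trans (ltnW (ltn_ord j)) ln.
Qed.

Lemma high_index_lt (n l : nat) (k : 'I_(n - l)) : (l + k < n)%N.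
Proof. by rewrite -ltn_subRL. Qed.

Lemma cast_Rank_rshift (s : nat -> nat) (n l : nat) (ln : (l <= n)%N)
    (k : 'I_(n - l)) (x : 'I_(s (l + k)%N)) :
  cast_ord (esym (sum_sizes_split s ln))
    (@tagnat.Rank n (fun i : 'I_n => s i) (Ordinal (high_index_lt k)) x) =
  rshift (\sum_(i < l) s i)
    (@tagnat.Rank (n - l) (fun i : 'I_(n - l) => s (l + i)%N) k x).
Proof.
apply: val_inj; apply: etrans (tagnat.RankEsum _) _.
apply: etrans _ (esym (congr1 (addn _) (tagnat.RankEsum _))).
rewrite addnA; congr (_ + _)%N.
rewrite -big_ord_widen ?(ltnW (high_index_lt k)) // big_split_ord /=.
by rewrite -(big_ord_widen _ (fun i => s (l + i)%N)) // ltnW.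
Qed.

Lemma blk_cast_block (R : pzRingType) (s : nat -> nat) (n l : nat)
    (ln : (l <= n)%N)
    (A : 'M[R]_(\sum_(i < l) s i))
    (B : 'M[R]_(\sum_(i < l) s i, \sum_(i < n - l) s (l + i)%N))
    (C : 'M[R]_(\sum_(i < n - l) s (l + i)%N, \sum_(i < l) s i))
    (D : 'M[R]_(\sum_(i < n - l) s (l + i)%N)) :
  let t := fun i => s (l + i)%N in
  let X := castmx (sum_sizes_split s ln, sum_sizes_split s ln)
             (block_mx A B C D) in
  [/\ forall j k : 'I_l, blk s s X j k = blk s s A j k,
      forall (j : 'I_l) (k : 'I_(n - l)), blk s s X j (l + k) = blk s t B j k,
      forall (j : 'I_(n - l)) (k : 'I_l), blk s s X (l + j) k = blk t s C j k &
      forall j k : 'I_(n - l), blk s s X (l + j) (l + k) = blk t t D j k].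
Proof.
move=> t X; split=> j k.
- rewrite -[val j]/(val (widen_ord ln j)) -[val k]/(val (widen_ord ln k)) !blkE.
  apply/matrixP => x y; rewrite !mxE castmxE.
  by rewrite !cast_Rank_lshift block_mxEul.
- rewrite -[val j]/(val (widen_ord ln j)).
  rewrite -[(l + k)%N]/(val (Ordinal (high_index_lt k))) !blkE.
  apply/matrixP => x y; rewrite !mxE castmxE.
  by rewrite cast_Rank_lshift cast_Rank_rshift block_mxEur.
- rewrite -[val k]/(val (widen_ord ln k)).
  rewrite -[(l + j)%N]/(val (Ordinal (high_index_lt j))) !blkE.
  apply/matrixP => x y; rewrite !mxE castmxE.
  by rewrite cast_Rank_lshift cast_Rank_rshift block_mxEdl.
rewrite -[(l + j)%N]/(val (Ordinal (high_index_lt j))).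
rewrite -[(l + k)%N]/(val (Ordinal (high_index_lt k))) !blkE.
apply/matrixP => x y; rewrite !mxE castmxE.
by rewrite !cast_Rank_rshift block_mxEdr.
Qed.

(** Case analysis that presents an index as [i] or as [l + i], the forms in
    which [blk_cast_block] expects it; writing it as [l + (i - l)] instead
    would change the type of the block. *)
Variant split_index_spec (l n : nat) : nat -> bool -> Type :=
  | SplitIndexLow (i : 'I_l) : split_index_spec l n i true
  | SplitIndexHigh (i : 'I_(n - l)) : split_index_spec l n (l + i) false.

Lemma split_indexP (n l i : nat) :
  (i < n)%N -> split_index_spec l n i (i < l)%N.
Proof.
move=> i_n; case: ltnP => [il|li]; first exact: (SplitIndexLow n (Ordinal il)).
have i_nl : (i - l < n - l)%N by rewrite ltn_sub2r // (leq_ltn_trans li).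
by have := SplitIndexHigh (Ordinal i_nl); rewrite /= subnKC.
Qed.

Definition corner_mx (R : pzRingType) (s : nat -> nat) (n l : nat)
    (ln : (l <= n)%N)
    (E : 'M[R]_(\sum_(i < l) s i, \sum_(i < n - l) s (l + i)%N)) :
    'M[R]_(\sum_(i < n) s i) :=
  castmx (sum_sizes_split s ln, sum_sizes_split s ln) (block_mx 0 E 0 0).

Lemma blk_corner_eq0 (R : pzRingType) (s : nat -> nat) (n l : nat)
    (ln : (l <= n)%N)
    (E : 'M[R]_(\sum_(i < l) s i, \sum_(i < n - l) s (l + i)%N)) (j k : nat) :
  ~~ (j < l <= k)%N -> blk s s (corner_mx ln E) j k = 0.
Proof.
have [/andP[jn kn]|out _] := boolP ((j < n) && (k < n))%N;
  last by rewrite blk_out.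
have [bul _ bdl bdr] := blk_cast_block ln 0 E 0 0.
rewrite [(l <= k)%N]leqNgt.
case: (split_indexP l jn) => j'; case: (split_indexP l kn) => k' //= _.
- by rewrite bul blk0.
- by rewrite bdl blk0.
- by rewrite bdr blk0.
Qed.

Lemma blk_corner (R : pzRingType) (s : nat -> nat) (n l : nat)
    (ln : (l <= n)%N)
    (E : 'M[R]_(\sum_(i < l) s i, \sum_(i < n - l) s (l + i)%N))
    (j : 'I_l) (k : 'I_(n - l)) :
  blk s s (corner_mx ln E) j (l + k) = blk s (fun i => s (l + i)%N) E j k.
Proof. by have [_ -> _ _] := blk_cast_block ln 0 E 0 0. Qed.

(** * The perturbation and its inverse *)

Lemma perturbE (R : pzRingType) (s : nat -> nat) (n l : nat)
    (ln : (l <= n)%N) (M : 'M[R]_(\sum_(i < n) s i))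
    (E : 'M[R]_(\sum_(i < l) s i, \sum_(i < n - l) s (l + i)%N)) :
  upper_from 0 M -> perturb ln M E = M + corner_mx ln E.
Proof.
move=> uM; rewrite /perturb.
have [eul eur edl edr] := blk_cast_block ln (blksub s s M 0 0 l l)
  (blksub s s M 0 l l (n - l) + E) 0 (blksub s s M l l (n - l) (n - l)).
apply: blkP => j k jn kn; rewrite blkD.
case: (split_indexP l jn) => j'; case: (split_indexP l kn) => k'.
- rewrite eul blk_corner_eq0 ?addr0 ?blk_mxblock //.
  by rewrite [(l <= k')%N]leqNgt !ltn_ord.
- by rewrite eur blkD blk_corner blk_mxblock.
- rewrite edl blk0 blk_corner_eq0 ?uM ?addr0 //.
    by rewrite addn0 (leq_trans (ltn_ord k')) ?leq_addr.
  by rewrite ltnNge leq_addr.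
by rewrite edr blk_corner_eq0 ?addr0 ?blk_mxblock // ltnNge leq_addr.
Qed.

(** In a term [F j a *m N a b *m F b k] of the product, a nonzero left factor
    needs [l <= a] and a nonzero right factor needs [b < l], so [b < a] and the
    middle factor vanishes. *)
Lemma corner_mul_upper_corner (R : pzRingType) (s : nat -> nat) (n l : nat)
    (ln : (l <= n)%N) (N : 'M[R]_(\sum_(i < n) s i))
    (E : 'M[R]_(\sum_(i < l) s i, \sum_(i < n - l) s (l + i)%N)) :
  upper_from 0 N -> corner_mx ln E *m N *m corner_mx ln E = 0.
Proof.
move=> uN; apply: blkP => j k _ _; rewrite blk0 blkM big1 // => b _.
have [bl|lb] := ltnP b l; last first.
  by rewrite [X in _ *m X]blk_corner_eq0 ?mulmx0 // ltnNge lb.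
rewrite blkM big1 ?mul0mx // => a _.
have [al|la] := ltnP a l.
  by rewrite blk_corner_eq0 ?mul0mx // [(l <= a)%N]leqNgt al andbF.
by rewrite [X in _ *m X]uN ?mulmx0 // addn0 (leq_trans bl).
Qed.

(** The series [N - N F N + N F N F N - ...] for the inverse of [M + F] stops
    after two terms because [F N F = 0]. *)
Lemma is_inverse_perturb (R : pzRingType) (d : nat) (M N F : 'M[R]_d) :
  is_inverse M N -> F *m N *m F = 0 ->
  is_inverse (M + F) (N - N *m F *m N).
Proof.
move=> [MN NM] FNF; split.
  rewrite mulmxDl !mulmxBr !mulmxA MN mul1mx FNF mul0mx subr0.
  by rewrite subrK.
rewrite mulmxDr !mulmxBl -!mulmxA NM mulmx1 (mulmxA F) FNF mulmx0 subr0.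
by rewrite subrK.
Qed.

(** The terms of the double sum for the block vanish outside the window
    [j <= a < l <= b <= k]; reindexing by [a = j + c] and [b = l + c'] turns
    what remains into a product of submatrices. *)
Lemma blk_upper_corner_upper (R : pzRingType) (s : nat -> nat) (n l : nat)
    (ln : (l <= n)%N) (N : 'M[R]_(\sum_(i < n) s i))
    (E : 'M[R]_(\sum_(i < l) s i, \sum_(i < n - l) s (l + i)%N)) (j k : nat) :
  upper_from 0 N -> (k < n)%N ->
  blk s s (N *m corner_mx ln E *m N) j k =
    if (j < l <= k)%N then
      (\mxrow_(c < l - j) blk s s N j (j + c))
        *m blksub s (fun i => s (l + i)%N) E j 0 (l - j) (k.+1 - l)
        *m (\mxcol_(c < k.+1 - l) blk s s N (l + c) k)
    else 0.
Proof.
move=> uN kn.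
(* Total in [a] and [b], as [sum_window] asks for vanishing at all naturals. *)
have G0 a b : ~~ ((j <= a < l) && (l <= b < k.+1))%N ->
    blk s s N j a *m blk s s (corner_mx ln E) a b *m blk s s N b k = 0.
  rewrite !ltnS.
  have [ja|aj _] := leqP j a; last by rewrite uN ?addn0 // !mul0mx.
  have [bk|kb _] := leqP b k; last by rewrite (uN b) ?addn0 // mulmx0.
  by rewrite andbT => ?; rewrite blk_corner_eq0 // mulmx0 mul0mx.
transitivity (\sum_(b < n) \sum_(a < n)
    blk s s N j a *m blk s s (corner_mx ln E) a b *m blk s s N b k).
  by rewrite blkM; apply: eq_bigr => b _; rewrite blkM mulmx_suml.
case: ifPn => [/andP[jl lk]|jlk]; last first.
  rewrite big1 // => b _; rewrite big1 // => a _; apply: G0.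
  apply: contra jlk => /andP[/andP[ja al] /andP[lb bk]].
  by rewrite (leq_ltn_trans ja al) (leq_trans lb bk).
rewrite mul_mxrow_mxblock mul_mxrow_mxcol.
rewrite (@sum_window _ n l k.+1 (fun b => \sum_(a < n)
    blk s s N j a *m blk s s (corner_mx ln E) a b *m blk s s N b k)); first last.
- by move=> b bP; rewrite big1 // => a _; apply: G0; rewrite negb_and bP orbT.
- by rewrite kn leqW.
apply: eq_bigr => c _; rewrite mulmx_suml.
rewrite (@sum_window _ n j l (fun a => blk s s N j a *m
    blk s s (corner_mx ln E) a (l + c) *m blk s s N (l + c) k)); first last.
- by move=> a aP; apply: G0; rewrite negb_and aP.
- by rewrite ltnW.
apply: eq_bigr => a _; congr (_ *m _ *m _).
have al : (j + a < l)%N by rewrite -ltn_subRL.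
have cl : (c < n - l)%N by rewrite (leq_trans (ltn_ord c)) // leq_sub2r.
exact: (blk_corner ln E (Ordinal al) (Ordinal cl)).
Qed.

Theorem corollary3p3 (R : pzRingType) (n : nat) (s : nat -> nat)
    (n_gt0 : (0 < n)%N)
    (s_gt0 : forall i : nat, (i < n)%N -> (0 < s i)%N)
    (M : 'M[R]_(\sum_(i < n) s i))
    (M_upper : forall j k : nat, (k < j < n)%N -> blk s s M j k = 0)
    (M_diag : forall k : nat, (k < n)%N -> invertible (blk s s M k k))
    (l : nat) (l_gt0 : (0 < l)%N) (l_ltn : (l < n)%N)
    (E : 'M[R]_(\sum_(i < l) s i, \sum_(i < n - l) s (l + i)%N)) :
  exists N Nt : 'M[R]_(\sum_(i < n) s i),
    [/\ is_inverse M N,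
        is_inverse (perturb (ltnW l_ltn) M E) Nt &
        forall j k : nat, (j < n)%N -> (k < n)%N ->
          blk s s Nt j k - blk s s N j k =
            if (j < l <= k)%N then
              - ((\mxrow_(c < l - j) blk s s N j (j + c))
                 *m blksub s (fun i => s (l + i)%N) E j 0 (l - j) (k.+1 - l)
                 *m (\mxcol_(c < k.+1 - l) blk s s N (l + c) k))
            else 0].
Proof.
have uM : upper_from 0 M.
  move=> j k; rewrite addn0 => kj.
  have [jn|jn] := ltnP j n; first by rewrite M_upper // kj.
  by rewrite blk_out // ltnNge jn.
have [N MN uN] := upper_inverse uM M_diag.
pose F := corner_mx (ltnW l_ltn) E.
exists N, (N - N *m F *m N); split=> //.
  rewrite perturbE //; apply: is_inverse_perturb => //.
  exact: corner_mul_upper_corner.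
move=> j k _ kn; rewrite blkD blkN addrC addKr blk_upper_corner_upper //.
by case: ifP; rewrite ?oppr0.
Qed.
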